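(* Let $\mathcal M=\mathbb R^n$ with its standard Euclidean metric, and let $X,Y$ be random variables in $\mathbb R^n$, each almost surely supported in a ball of finite radius, with Fréchet means $\mu,\nu$. Then the Riemannian covariance reduces to the standard Euclidean covariance: for every $p$ on the segment from $\mu$ to $\nu$, $$\operatorname{Cov}_{X,Y}(p)=\operatorname{tr}\,\mathbb E\big[(X-\mathbb E X)(Y-\mathbb E Y)^T\big].$$
   Context: For random variables $X,Y$ on a Riemannian manifold $\mathcal M$ with distance $d$, the Fréchet mean of $Z$ is the minimizer of $x\mapsto\mathbb E[d^2(x,Z)]$. With $\mu,\nu$ the Fréchet means of $X,Y$, $\alpha$ the minimizing geodesic from $\mu$ to $\nu$, $\log_p$ the Riemannian logarithm map and $\Gamma_a^b$ Levi-Civita parallel transport along $\alpha$ from $a$ to $b$, the Riemannian cross-covariance at $p\in\alpha$ is $$\Sigma_{X,Y}(p)=\mathbb E\big[(\Gamma_\mu^p\log_\mu X)(\Gamma_\nu^p\log_\nu Y)^T\big]$$ (coordinates in an orthonormal basis of $T_p\mathcal M$), and the Riemannian covariance is $\operatorname{Cov}_{X,Y}(p)=\operatorname{tr}(\Sigma_{X,Y}(p))$. *)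

(* Defs.v *)
From HB Require Import structures.
From mathcomp Require Import all_boot all_order all_algebra.
From mathcomp Require Import all_classical all_reals all_analysis.
Import Order.TTheory GRing.Theory Num.Theory.
Import numFieldNormedType.Exports.

Set Implicit Arguments.
Unset Strict Implicit.
Unset Printing Implicit Defensive.

Local Open Scope classical_set_scope.
Local Open Scope ring_scope.

(* Riemannian geometry of a manifold covered by one global chart R^n. Points
   and tangent vectors are columns; the metric is given by its Gram matrices
   g x in the coordinate frame. Nothing here depends on the norm that the
   library puts on matrices, which is the sup norm. *)
Section Riemannian.
Context {R : realType} {n : nat}.
Implicit Types (g : 'cV[R]_n -> 'M[R]_n) (gamma V : R -> 'cV[R]_n).
Implicit Types (x y v w : 'cV[R]_n).

Definition euclidean_metric : 'cV[R]_n -> 'M[R]_n := fun=> 1%:M.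

Definition tangent_norm g x v : R := Num.sqrt ((v^T *m g x *m v) 0 0).

Definition curve_coord gamma (i : 'I_n) : R -> R := fun t => gamma t i 0.

Definition velocity gamma (t : R) : 'cV[R]_n := \col_i derive1 (curve_coord gamma i) t.

(* Derivatives are two-sided at 0 and 1 too: a C^1 path is one that extends
   to a differentiable path around [0, 1]. *)
Definition C1_path gamma : Prop := forall i,
  {in `[0, 1], forall t : R, derivable (curve_coord gamma i) t 1} /\
  {within `[0, 1], continuous (derive1 (curve_coord gamma i))}.

Definition curve_length g gamma : R :=
  \int[lebesgue_measure]_(t in `[0, 1]) tangent_norm g (gamma t) (velocity gamma t).

Definition rdist g x y : R :=
  inf [set l | exists gamma,
    [/\ C1_path gamma, gamma 0 = x, gamma 1 = y & l = curve_length g gamma]].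

(* partial_metric g x i j l = d g_jl / d x_i at x *)
Definition partial_metric g x (i j l : 'I_n) : R :=
  derive1 (fun h : R => g (x + h *: delta_mx i 0) j l) 0.

(* The Christoffel symbol of the Levi-Civita connection with upper index k. *)
Definition christoffel g x (k i j : 'I_n) : R :=
  2^-1 * \sum_(l < n) invmx (g x) k l *
    (partial_metric g x i j l + partial_metric g x j i l
     - partial_metric g x l i j).

Definition parallel g gamma V : Prop := forall (t : R) (k : 'I_n),
  t \in `[0, 1] ->
  derivable (curve_coord V k) t 1 /\
  derive1 (curve_coord V k) t
    + \sum_(i < n) \sum_(j < n) christoffel g (gamma t) k i j
        * velocity gamma t i 0 * V t j 0 = 0.

Definition geodesic g gamma : Prop :=
  (forall (t : R) (i : 'I_n), t \in `[0, 1] ->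
     \forall s \near t, derivable (curve_coord gamma i) s 1) /\
  parallel g gamma (velocity gamma).

Definition minimizing_geodesic g x y gamma : Prop :=
  [/\ geodesic g gamma, gamma 0 = x, gamma 1 = y
    & curve_length g gamma = rdist g x y].

(* The v with exp_p v = x for which t |-> exp_p (t v) is minimizing (0 if
   there is none). *)
Definition rlog g (p x : 'cV[R]_n) : 'cV[R]_n :=
  xget 0 [set v | exists gamma,
    minimizing_geodesic g p x gamma /\ velocity gamma 0 = v].

(* Parallel transport of v along alpha from its point a to its point b. *)
Definition transport g (alpha : R -> 'cV[R]_n) (a b v : 'cV[R]_n) : 'cV[R]_n :=
  xget 0 [set w | exists V (s t : R),
    [/\ s \in `[0, 1], t \in `[0, 1], alpha s = a & alpha t = b] /\
    [/\ parallel g alpha V, V s = v & V t = w]].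

(* The columns of B form an orthonormal basis of the tangent space at p. *)
Definition orthonormal_basis g (p : 'cV[R]_n) (B : 'M[R]_n) : Prop :=
  B^T *m g p *m B = 1%:M.

Definition basis_coords g (p : 'cV[R]_n) (B : 'M[R]_n) v : 'cV[R]_n :=
  B^T *m g p *m v.

End Riemannian.

Section Covariance.
Context {d : measure_display} {T : measurableType d} {R : realType}.
Variable P : probability T R.

Definition mx_expectation {m k : nat} (M : T -> 'M[R]_(m, k)) : 'M[R]_(m, k) :=
  \matrix_(i < m, j < k) fine ('E_P[fun w => M w i j]).

Context {n : nat}.
Implicit Types (g : 'cV[R]_n -> 'M[R]_n) (X Y Z : T -> 'cV[R]_n).

(* Coordinatewise, i.e. Borel measurability. *)
Definition random_vector X : Prop :=
  forall i, measurable_fun [set: T] (fun w => X w i 0 : R).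

Definition ae_bounded g X : Prop :=
  exists (c : 'cV[R]_n) (r : R), {ae P, forall w, rdist g c (X w) < r}.

Definition frechet_mean g Z (mu : 'cV[R]_n) : Prop :=
  forall x : 'cV[R]_n,
  ('E_P[fun w => (rdist g mu (Z w) ^+ 2)%R]
     <= 'E_P[fun w => (rdist g x (Z w) ^+ 2)%R])%E.

Definition cross_covariance g X Y (mu nu : 'cV[R]_n) (alpha : R -> 'cV[R]_n)
    (p : 'cV[R]_n) (B : 'M[R]_n) : 'M[R]_n :=
  mx_expectation (fun w =>
    basis_coords g p B (transport g alpha mu p (rlog g mu (X w))) *m
    (basis_coords g p B (transport g alpha nu p (rlog g nu (Y w))))^T).

Definition riemannian_covariance g X Y (mu nu : 'cV[R]_n)
    (alpha : R -> 'cV[R]_n) (p : 'cV[R]_n) (B : 'M[R]_n) : R :=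
  \tr (cross_covariance g X Y mu nu alpha p B).

End Covariance.

(* Main.v *)
(* In the Euclidean metric all Christoffel symbols vanish, so parallel fields
   are constant and geodesics are affine: transport is the identity. If u is
   the displacement of a C^1 path gamma, then integrating u . gamma' and using
   Cauchy-Schwarz gives |u|^2 <= |u| * length gamma; hence rdist is the
   Euclidean distance, segments are minimizing, and log_x y = y - x.
   Completing the square in E|x - Z|^2 identifies the Frechet mean with E Z.
   Finally tr (B^T A B) = tr A because B B^T = 1. *)

Require Import Defs.
From HB Require Import structures.
From mathcomp Require Import all_boot all_order all_algebra.
From mathcomp Require Import all_classical all_reals all_analysis.
From mathcomp Require Import measurable_realfun ring lra.
Import Order.TTheory GRing.Theory Num.Theory.
Import numFieldNormedType.Exports.
Local Open Scope ring_scope.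

Set Implicit Arguments.
Unset Strict Implicit.

(** * Real functions with constant derivative on [[0, 1]] *)

Section UnitInterval.
Context {R : realType}.
Implicit Types (f : R -> R).

(** Mean value theorem on the segment between the two points; two-sided derivability at 0 and 1
    supplies continuity up to the endpoints. *)
Lemma derive1_eq0_cst01 f :
  {in `[0, 1], forall t : R, derivable f t 1} ->
  {in `[0, 1], forall t : R, derive1 f t = 0} ->
  {in `[0, 1] &, forall s t : R, f s = f t}.
Proof.
move=> df f0.
suff H s t : s \in `[0, 1] -> t \in `[0, 1] -> s <= t -> f s = f t.
  move=> s t hs ht; case/orP: (le_total s t) => st; first exact: H.
  by apply/esym/H.
move=> hs ht st.
have sub x : x \in `[s, t] -> x \in `[0, 1].
  move: hs ht; rewrite !in_itv/= => /andP[? ?] /andP[? ?] /andP[? ?].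
  by apply/andP; split; lra.
have [] := @MVT_segment R f (derive1 f) s t st.
- move=> x xst; rewrite derive1E; apply: derivableP; apply: df.
  by apply: sub; apply: subset_itv_oo_cc xst.
- by apply: derivable_within_continuous => x /sub; exact: df.
- by move=> c /sub /f0 -> /eqP; rewrite mul0r subr_eq0 => /eqP.
Qed.

Lemma is_derive_affine (a b t : R) : is_derive t 1 (fun s : R => a + s * b) b.
Proof.
have := is_deriveD (is_derive_cst a t 1)
  (is_deriveZ b (is_derive_id t (1 : R))).
rewrite add0r -[X in is_derive _ _ _ X]/(b * 1) mulr1.
congr is_derive; apply/funext => s.
by rewrite /= !fctE /GRing.scale/= mulrC.
Qed.

Lemma derive1_affine (a b t : R) : derive1 (fun s : R => a + s * b) t = b.
Proof. by rewrite derive1E; have [_ ->] := is_derive_affine a b t. Qed.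

Lemma derivable_affine (a b t : R) : derivable (fun s : R => a + s * b) t 1.
Proof. by have [] := is_derive_affine a b t. Qed.

(** Subtracting the affine function of slope [c] reduces this to a vanishing derivative. *)
Lemma derive1_cst_affine01 f (c : R) :
  {in `[0, 1], forall t : R, derivable f t 1} ->
  {in `[0, 1], forall t : R, derive1 f t = c} ->
  {in `[0, 1], forall t : R, f t = f 0 + t * c}.
Proof.
move=> df fc t t01.
have i01 (s : R) : s \in `[0, 1] -> is_derive s 1 (f - (fun s => 0 + s * c)) 0.
  move=> s01.
  have Hf : is_derive s 1 f c by rewrite -(fc s s01) derive1E; exact/derivableP/df.
  by rewrite -(subrr c); apply: is_deriveB Hf (is_derive_affine _ _ _).
have := @derive1_eq0_cst01 (f - (fun s => 0 + s * c)).
move=> /(_ _ _ t 0 t01).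
rewrite !fctE mul0r addr0 subr0 add0r => <-.
- by rewrite subrK.
- by move=> s /i01 [].
- by move=> s /i01 [_ H]; rewrite derive1E H.
- by rewrite in_itv/= lexx ler01.
Qed.

End UnitInterval.

(** * Geometry of the Euclidean metric: geodesics, distance, logarithm, transport *)

Section EuclideanGeometry.
Local Open Scope classical_set_scope.
Local Open Scope ring_scope.
Context {R : realType} {n : nat}.
Implicit Types (gamma V : R -> 'cV[R]_n) (x y u v : 'cV[R]_n).
Local Notation E := (@euclidean_metric R n).

Definition dot u v : R := \sum_i u i 0 * v i 0.

Definition enorm v : R := Num.sqrt (dot v v).

Lemma tangent_norm_euclidean x v : tangent_norm E x v = enorm v.
Proof.
rewrite /tangent_norm /enorm mulmx1 mxE; congr Num.sqrt.
by apply: eq_bigr => i _; rewrite mxE.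
Qed.

Lemma dot_ge0 v : 0 <= dot v v.
Proof. by apply: sumr_ge0 => i _; rewrite -expr2 sqr_ge0. Qed.

Lemma sqr_enorm v : enorm v ^+ 2 = dot v v.
Proof. by rewrite sqr_sqrtr ?dot_ge0. Qed.

Lemma enorm_ge0 v : 0 <= enorm v.
Proof. exact: sqrtr_ge0. Qed.

Lemma enorm_eq0 v : enorm v = 0 -> v = 0.
Proof.
move=> v0; apply/matrixP => i j; rewrite mxE ord1.
have /eqP := sqr_enorm v; rewrite v0 expr0n eq_sym /dot.
rewrite psumr_eq0 => [/allP/(_ i (mem_index_enum i))|k _].
  by rewrite -expr2 sqrf_eq0 => /eqP.
by rewrite -expr2 sqr_ge0.
Qed.

Lemma normr_coord_le_enorm v (i : 'I_n) : `|v i 0| <= enorm v.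
Proof.
rewrite -sqrtr_sqr ler_sqrt ?dot_ge0// /dot (bigD1 i)//= -expr2 lerDl.
by apply: sumr_ge0 => k _; rewrite -expr2 sqr_ge0.
Qed.

Lemma dot_le_enorm u v : dot u v <= enorm u * enorm v.
Proof.
(* Null vectors are split off because the last step cancels the factor [enorm u * enorm v]. *)
have [u0|u0] := eqVneq (enorm u) 0.
  rewrite u0 mul0r (enorm_eq0 u0) /dot big1// => i _; by rewrite mxE mul0r.
have [v0|v0] := eqVneq (enorm v) 0.
  rewrite v0 mulr0 (enorm_eq0 v0) /dot big1// => i _; by rewrite mxE mulr0.
have ab : 0 < enorm u * enorm v.
  by rewrite mulr_gt0// lt_def ?u0 ?v0 enorm_ge0.
(* Expand [0 <= | |v| u - |u| v |^2]. *)
have := dot_ge0 (enorm v *: u - enorm u *: v).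
have -> : dot (enorm v *: u - enorm u *: v) (enorm v *: u - enorm u *: v)
    = enorm v ^+ 2 * dot u u + enorm u ^+ 2 * dot v v
      - 2 * (enorm u * enorm v) * dot u v.
  rewrite /dot !mulr_sumr -big_split/= -sumrB; apply: eq_bigr => i _.
  by rewrite !mxE; ring.
rewrite -!sqr_enorm => h.
have : 0 <= (enorm u * enorm v) * (enorm u * enorm v - dot u v) by lra.
by rewrite pmulr_rge0// subr_ge0.
Qed.

(** The Gram matrix is the same at every point, so its partial derivatives vanish. *)
Lemma christoffel_euclidean x (k i j : 'I_n) : christoffel E x k i j = 0.
Proof.
have pm (a b c : 'I_n) : partial_metric E x a b c = 0 by exact: derive1_cst.
by rewrite /christoffel big1 ?mulr0// => l _; rewrite !pm addr0 subr0 mulr0.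
Qed.

(** The curve enters the transport equation only through the Christoffel terms, so [gamma] drops
    out. *)
Lemma parallel_euclideanP gamma V : parallel E gamma V <->
  forall (t : R) (k : 'I_n), t \in `[0, 1] ->
  derivable (curve_coord V k) t 1 /\ derive1 (curve_coord V k) t = 0.
Proof.
have H t k : \sum_(i < n) \sum_(j < n) christoffel E (gamma t) k i j
        * velocity gamma t i 0 * V t j 0 = 0.
  rewrite big1// => i _; rewrite big1// => j _.
  by rewrite christoffel_euclidean !mul0r.
by split=> P t k /(P t k); rewrite H addr0.
Qed.

Lemma parallel_euclidean_cst gamma V : parallel E gamma V ->
  {in `[0, 1] &, forall s t : R, V s = V t}.
Proof.
move=> /parallel_euclideanP PV s t hs ht; apply/matrixP => i j; rewrite ord1.
apply: (@derive1_eq0_cst01 _ (curve_coord V i)) => // r hr.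
- by have [] := PV r i hr.
- by have [] := PV r i hr.
Qed.

Lemma cst_parallel_euclidean gamma v : parallel E gamma (fun=> v).
Proof.
apply/parallel_euclideanP => t k _; split; first exact: derivable_cst.
exact: derive1_cst.
Qed.

Lemma in01_0 : (0 : R) \in `[0, 1].
Proof. by rewrite in_itv/= lexx ler01. Qed.

Lemma in01_1 : (1 : R) \in `[0, 1].
Proof. by rewrite in_itv/= lexx ler01. Qed.

(** The velocity is a parallel field, hence constant on [[0, 1]], so each coordinate has constant
    derivative. *)
Lemma geodesic_euclidean_affine gamma : geodesic E gamma ->
  {in `[0, 1], forall t : R, gamma t = gamma 0 + t *: velocity gamma 0}.
Proof.
move=> [dg pg] t t01; apply/matrixP => i j; rewrite ord1 !mxE.
apply: (@derive1_cst_affine01 _ (curve_coord gamma i)) => // s s01.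
- exact: (nbhs_singleton (dg s i s01)).
- have := parallel_euclidean_cst pg s01 in01_0.
  by move=> /matrixP /(_ i 0); rewrite !mxE.
Qed.

Lemma geodesic_euclidean_velocity gamma : geodesic E gamma ->
  velocity gamma 0 = gamma 1 - gamma 0.
Proof.
move=> /geodesic_euclidean_affine /(_ 1 in01_1) ->.
by rewrite scale1r addrC addKr.
Qed.

(** Taken on all of [R], to have the two-sided derivatives at 0 and 1 that [C1_path] and [geodesic]
    ask for. *)
Definition line x y : R -> 'cV[R]_n := fun t => x + t *: (y - x).

Lemma curve_coord_line x y i :
  curve_coord (line x y) i = fun t => x i 0 + t * (y - x) i 0.
Proof. by apply/funext => t; rewrite /curve_coord !mxE. Qed.

Lemma velocity_line x y : velocity (line x y) = cst (y - x).
Proof.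
apply/funext => t; apply/matrixP => i j; rewrite ord1 !mxE curve_coord_line.
by rewrite derive1_affine !mxE.
Qed.

Lemma line0 x y : line x y 0 = x.
Proof. by rewrite /line scale0r addr0. Qed.

Lemma line1 x y : line x y 1 = y.
Proof. by rewrite /line scale1r addrC subrK. Qed.

Lemma line_geodesic x y : geodesic E (line x y).
Proof.
split=> [t i _|].
  rewrite curve_coord_line; apply: filterE => s; exact: derivable_affine.
by rewrite velocity_line; exact: cst_parallel_euclidean.
Qed.

Lemma line_C1 x y : C1_path (line x y).
Proof.
move=> i; rewrite curve_coord_line; split=> [t _|].
  exact: derivable_affine.
have -> : derive1 (fun t => x i 0 + t * (y - x) i 0) = cst ((y - x) i 0).
  by apply/funext => t; rewrite derive1_affine.
exact: (continuous_subspaceT (@cst_continuous _ _ _)).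
Qed.

(** * Lengths of paths and the Euclidean distance *)

Lemma curve_length_euclidean gamma : curve_length E gamma =
  \int[lebesgue_measure]_(t in `[0, 1]) enorm (velocity gamma t).
Proof. by apply: eq_Rintegral => t _; rewrite tangent_norm_euclidean. Qed.

Lemma curve_length_line x y : curve_length E (line x y) = enorm (y - x).
Proof.
rewrite curve_length_euclidean velocity_line.
rewrite /cst Rintegral_cst//= lebesgue_measure_itv/= lte_fin ltr01.
by rewrite oppr0 adde0 mulr1.
Qed.

Lemma within_continuous_dot (A : set R) (f g : R -> 'cV[R]_n) :
  (forall i, {within A, continuous (fun t => f t i 0)}) ->
  (forall i, {within A, continuous (fun t => g t i 0)}) ->
  {within A, continuous (fun t => dot (f t) (g t))}.
Proof.
move=> cf cg t; rewrite /dot.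
apply: cvg_big; first exact: add_continuous.
by move=> i _; apply: cvgM; [exact: cf|exact: cg].
Qed.

Lemma C1_path_velocity_continuous gamma i : C1_path gamma ->
  {within `[0, 1], continuous (fun t : R => velocity gamma t i 0)}.
Proof.
move=> /(_ i)[_ c1]; suff <- : derive1 (curve_coord gamma i) =
  (fun t => velocity gamma t i 0) by [].
by apply/funext => t; rewrite mxE.
Qed.

(** Makes the speed integrable on [[0, 1]]. Zeros of the velocity do no harm: [Num.sqrt] is
    continuous at 0 too. *)
Lemma C1_path_enorm_continuous gamma : C1_path gamma ->
  {within `[0, 1], continuous (fun t : R => enorm (velocity gamma t))}.
Proof.
move=> C1; apply: (@within_continuous_comp _ _ _ _
  (fun t : R => dot (velocity gamma t) (velocity gamma t)) Num.sqrt).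
  by move=> ? _; exact: sqrt_continuous.
by apply: within_continuous_dot => i; exact: C1_path_velocity_continuous.
Qed.

Lemma enorm_le_curve_length gamma : C1_path gamma ->
  enorm (gamma 1 - gamma 0) <= curve_length E gamma.
Proof.
move=> C1; set u := gamma 1 - gamma 0.
(* Settles the case [enorm u = 0] at the end, where that factor cannot be cancelled. *)
have L0 : 0 <= curve_length E gamma.
  by apply: Rintegral_ge0 => t _; exact: sqrtr_ge0.
have cu : compact (`[0, 1] : set R) by exact: segment_compact.
have iv : lebesgue_measure.-integrable `[0, 1]
    (EFin \o fun t : R => enorm (velocity gamma t)).
  exact: continuous_compact_integrable (C1_path_enorm_continuous C1).
(* The inner product of [u] with [gamma t]: a scalar function, to which the fundamental theorem of
   calculus applies, with derivative [dh]. *)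
pose h (t : R) := \sum_i u i 0 * curve_coord gamma i t.
pose dh (t : R) := dot u (velocity gamma t).
have hE : h = \sum_i (u i 0 *: curve_coord gamma i).
  by apply/funext => t; rewrite fct_sumE.
have dC (t : R) i : t \in `[0, 1] ->
    derivable (u i 0 *: curve_coord gamma i) t 1.
  by move=> t01; apply: derivableZ; have [/(_ t t01)] := C1 i.
have dhh (t : R) : t \in `[0, 1] -> derivable h t 1 /\ derive1 h t = dh t.
  move=> t01; rewrite hE; split.
    by apply: derivable_sum => i; exact: dC.
  rewrite derive1E derive_sum => [|i]; last exact: dC.
  apply: eq_bigr => i _; rewrite [velocity _ _ _ _]mxE deriveZ; last by have [/(_ t t01)] := C1 i.
  by rewrite derive1E.
have cdh : {within `[0, 1], continuous dh}.
  apply: within_continuous_dot => i; last exact: C1_path_velocity_continuous.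
  exact: (continuous_subspaceT (@cst_continuous _ _ _)).
have idh : lebesgue_measure.-integrable `[0, 1] (EFin \o dh).
  exact: continuous_compact_integrable.
have hc : {within `[0, 1], continuous h}.
  by apply: derivable_within_continuous => t /dhh[].
have FTC : (\int[lebesgue_measure]_(t in `[0, 1]) dh t)%R = h 1 - h 0.
  rewrite /Rintegral (@continuous_FTC2 _ dh h 0 1 ltr01 cdh)//.
  - have [h1 h2 h3] := (continuous_within_itvP h ltr01).1 hc.
    split=> //.
    by move=> t /subset_itv_oo_cc /dhh[].
  - by move=> t /subset_itv_oo_cc /dhh[].
(* By linearity the increment of [h] is the inner product of [u] with [gamma 1 - gamma 0], which is
   [u] itself. *)
have : h 1 - h 0 = enorm u * enorm u.
  rewrite -expr2 sqr_enorm -sumrB; apply: eq_bigr => i _.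
  by rewrite -mulrBr /u !mxE.
rewrite -FTC => Eu.
have : enorm u * enorm u <= enorm u * curve_length E gamma.
  rewrite -Eu curve_length_euclidean -RintegralZl//.
  apply: le_Rintegral => //; first exact: integrableZl iv.
  by move=> t _; exact: dot_le_enorm.
have [->//|u0] := eqVneq (enorm u) 0.
by rewrite ler_pM2l// lt_def u0 enorm_ge0.
Qed.

(** The segment attains the infimum, and [enorm_le_curve_length] bounds every other path from
    below. *)
Lemma rdist_euclidean x y : rdist E x y = enorm (y - x).
Proof.
apply/eqP; rewrite eq_le; apply/andP; split.
  rewrite -curve_length_line; apply: inf_lbound.
    (* An infimum lies below the members of a set only if the set has a lower bound; lengths are
       nonnegative, so 0 serves. *)
    by exists 0 => l [g [_ _ _ ->]]; apply: Rintegral_ge0 => t _; exact: sqrtr_ge0.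
  by exists (line x y); split; [exact: line_C1|exact: line0|exact: line1|].
apply: lb_le_inf.
  exists (curve_length E (line x y)), (line x y).
  by split; [exact: line_C1|exact: line0|exact: line1|].
by move=> l [g [C1 <- <- ->]]; exact: enorm_le_curve_length.
Qed.

Lemma rlog_euclidean x y : rlog E x y = y - x.
Proof.
rewrite /rlog; case: xgetP => [v _ [g [[gg g0 g1 _] <-]]|].
  by rewrite geodesic_euclidean_velocity// g0 g1.
(* The default 0 of [xget] is excluded, since the segment provides a candidate. *)
move=> /(_ (y - x)) []; exists (line x y); split; last by rewrite velocity_line.
split; [exact: line_geodesic|exact: line0|exact: line1|].
by rewrite curve_length_line rdist_euclidean.
Qed.

Lemma transport_euclidean gamma (s t : R) v : s \in `[0, 1] -> t \in `[0, 1] ->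
  transport E gamma (gamma s) (gamma t) v = v.
Proof.
move=> s01 t01; rewrite /transport; case: xgetP => [w _|].
  (* The curve may pass through the two points at times [s'], [t'] other than [s], [t]; a parallel
     field is constant on [[0, 1]], so the value is the same. *)
  move=> [V [s' [t' [[hs ht _ _] [pV <- <-]]]]].
  exact: parallel_euclidean_cst pV _ _ ht hs.
move=> /(_ v) []; exists (fun=> v), s, t; split; split=> //.
exact: cst_parallel_euclidean.
Qed.

End EuclideanGeometry.

(** * Expectations of almost surely bounded functions *)

Section AeBounded.
Context {d : measure_display} {T : measurableType d} {R : realType}.
Variable P : probability T R.
Implicit Types (f g : T -> R).
Local Open Scope classical_set_scope.
Local Open Scope ring_scope.

(** Closed under sums and products, unlike integrability, and contained in the integrable functions
    because [P] is finite. *)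
Definition ae_bounded_fun f : Prop :=
  measurable_fun [set: T] f /\ exists r : R, {ae P, forall w, `|f w| <= r}.

Lemma ae_bounded_fun_cst (c : R) : ae_bounded_fun (fun=> c).
Proof.
split; first exact: measurable_cst.
by exists `|c|; apply: aeW => w.
Qed.

Lemma ae_bounded_funD f g : ae_bounded_fun f -> ae_bounded_fun g ->
  ae_bounded_fun (fun w => f w + g w).
Proof.
move=> [mf [r fr]] [mg [s gs]]; split; first exact: measurable_funD.
exists (r + s); apply: filterS2 fr gs => w fr gs.
by rewrite (le_trans (ler_normD _ _))// lerD.
Qed.

Lemma ae_bounded_funM f g : ae_bounded_fun f -> ae_bounded_fun g ->
  ae_bounded_fun (fun w => f w * g w).
Proof.
move=> [mf [r fr]] [mg [s gs]]; split; first exact: measurable_funM.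
exists (r * s); apply: filterS2 fr gs => w fr gs.
by rewrite normrM ler_pM.
Qed.

Lemma ae_bounded_fun_sum I (s : seq I) (F : I -> T -> R) :
  (forall i, ae_bounded_fun (F i)) ->
  ae_bounded_fun (fun w => \sum_(i <- s) F i w).
Proof.
move=> bF; elim: s => [|i s IH].
  by under eq_fun do rewrite big_nil; exact: ae_bounded_fun_cst.
by under eq_fun do rewrite big_cons; exact: ae_bounded_funD.
Qed.

Lemma ae_bounded_fun_integrable f : ae_bounded_fun f ->
  P.-integrable [set: T] (EFin \o f).
Proof.
move=> [mf [r fr]]; apply/integrableP; split; first exact/measurable_EFinP.
(* The absolute value of [r] keeps the dominating constant nonnegative, as the comparison of
   integrals requires. *)
apply: (@le_lt_trans _ _ (\int[P]_w `|r|%:E)%E).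
  apply: ae_ge0_le_integral => //.
  - by do 2 apply: measurableT_comp => //.
  - move: fr; apply: filterS => w fr _.
    by rewrite /= lee_fin (le_trans fr)// ler_norm.
by rewrite integral_cst//= probability_setT mule1 ltry.
Qed.

Lemma Rintegral_sum_ae_bounded I (s : seq I) (F : I -> T -> R) :
  (forall i, ae_bounded_fun (F i)) ->
  \int[P]_w (\sum_(i <- s) F i w) = \sum_(i <- s) \int[P]_w F i w.
Proof.
move=> bF; elim: s => [|i s IH].
  under eq_Rintegral do rewrite big_nil.
  by rewrite big_nil Rintegral_cst// mul0r.
under eq_Rintegral do rewrite big_cons.
rewrite big_cons -IH RintegralD//; first exact: ae_bounded_fun_integrable.
exact/ae_bounded_fun_integrable/ae_bounded_fun_sum.
Qed.

Lemma Rintegral_sqrB f (c : R) : ae_bounded_fun f ->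
  \int[P]_w ((f w - c) * (f w - c)) =
  \int[P]_w (f w * f w) - 2 * c * \int[P]_w f w + c ^+ 2.
Proof.
move=> bf.
have bff := ae_bounded_funM bf bf.
have bcf : ae_bounded_fun (fun w => (- (2 * c)) * f w).
  by apply: ae_bounded_funM => //; exact: ae_bounded_fun_cst.
under eq_Rintegral => w _.
  (* A sum with the coefficient [- (2 * c)] in front lets additivity and homogeneity of the integral
     apply directly. *)
  rewrite (_ : _ * _ = f w * f w + (- (2 * c)) * f w + c ^+ 2); last by ring.
  over.
rewrite RintegralD//; last 2 first.
- exact/ae_bounded_fun_integrable/ae_bounded_funD.
- exact/ae_bounded_fun_integrable/ae_bounded_fun_cst.
rewrite RintegralD//; [|exact: ae_bounded_fun_integrable..].
rewrite RintegralZl//; last exact: ae_bounded_fun_integrable.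
rewrite Rintegral_cst//= probability_setT/=; ring.
Qed.

Lemma expectation_ae_bounded f : ae_bounded_fun f ->
  ('E_P[f])%E = (\int[P]_w f w)%:E.
Proof.
move=> /ae_bounded_fun_integrable/integrable_fin_num bf.
by rewrite unlock /Rintegral fineK// bf.
Qed.

Lemma mx_expectationE m k (M : T -> 'M[R]_(m, k)) i j :
  mx_expectation P M i j = \int[P]_w M w i j.
Proof. by rewrite mxE unlock. Qed.

Lemma mxtrace_expectation m (M : T -> 'M[R]_m) :
  (forall i j, ae_bounded_fun (fun w => M w i j)) ->
  \tr (mx_expectation P M) = \int[P]_w \tr (M w).
Proof.
move=> bM; rewrite Rintegral_sum_ae_bounded//; apply: eq_bigr => i _.
by rewrite mx_expectationE.
Qed.

Lemma ae_bounded_fun_mulmx m k l (M : T -> 'M[R]_(m, k)) (N : T -> 'M[R]_(k, l)) :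
  (forall i j, ae_bounded_fun (fun w => M w i j)) ->
  (forall i j, ae_bounded_fun (fun w => N w i j)) ->
  forall i j, ae_bounded_fun (fun w => (M w *m N w) i j).
Proof.
move=> bM bN i j; under eq_fun do rewrite mxE.
by apply: ae_bounded_fun_sum => a; exact: ae_bounded_funM.
Qed.

(** * Bounded random vectors and their Fréchet mean *)

Context {n : nat}.
Implicit Types (X Z : T -> 'cV[R]_n).
Local Notation E := (@euclidean_metric R n).

(** Triangle inequality through the centre [c]: a coordinate of [X w - c] is at most its Euclidean
    norm, which is below [r]. *)
Lemma ae_bounded_coord X i j : random_vector X -> ae_bounded P E X ->
  ae_bounded_fun (fun w => X w i j).
Proof.
rewrite ord1 => mX [c [r Xr]]; split; first exact: mX.
exists (`|c i 0| + r); apply: filterS Xr => w.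
rewrite rdist_euclidean => /ltW Xr.
rewrite -(subrK (c i 0) (X w i 0)) addrC (le_trans (ler_normD _ _))// lerD2l.
apply: le_trans Xr; apply: le_trans (normr_coord_le_enorm _ i).
by rewrite !mxE.
Qed.

Lemma frechet_mean_euclidean Z (mu : 'cV[R]_n) :
  random_vector Z -> ae_bounded P E Z -> frechet_mean P E Z mu ->
  mu = mx_expectation P Z.
Proof.
(* Minimality is tested against the single competitor [m], the expectation. *)
move=> mZ bZ; set m := mx_expectation P Z => /(_ m).
have bc i : ae_bounded_fun (fun w => Z w i 0) by exact: ae_bounded_coord.
have bd x i : ae_bounded_fun (fun w => (Z w i 0 - x) * (Z w i 0 - x)).
  have b : ae_bounded_fun (fun w => Z w i 0 - x).
    by apply: ae_bounded_funD => //; exact: ae_bounded_fun_cst.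
  exact: ae_bounded_funM.
(* The objective is a finite quadratic polynomial in [x], so the comparison becomes one between real
   numbers. *)
have Ed (x : 'cV[R]_n) : ('E_P[fun w => (rdist E x (Z w) ^+ 2)%R])%E =
    (\sum_i (\int[P]_w (Z w i 0 * Z w i 0) - 2 * x i 0 * m i 0
             + x i 0 ^+ 2))%:E.
  rewrite (_ : (fun w => _) =
      fun w => \sum_i (Z w i 0 - x i 0) * (Z w i 0 - x i 0)); last first.
    apply/funext => w; rewrite rdist_euclidean sqr_enorm.
    by apply: eq_bigr => i _; rewrite !mxE.
  rewrite expectation_ae_bounded; last exact: ae_bounded_fun_sum.
  rewrite Rintegral_sum_ae_bounded//; congr EFin; apply: eq_bigr => i _.
  by rewrite Rintegral_sqrB// mx_expectationE.
(* The value at [m] minus the value at [mu] is [- dot (mu - m) (mu - m)], so its nonnegativity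
   forces [mu = m]. *)
rewrite !Ed lee_fin -subr_ge0 -sumrB => h.
apply/eqP; rewrite -subr_eq0; apply/eqP/enorm_eq0.
rewrite /enorm; apply: ler0_sqrtr.
rewrite -oppr_ge0 /dot -sumrN; apply: le_trans h _; rewrite le_eqVlt.
apply/orP; left; apply/eqP; apply: eq_bigr => i _.
rewrite [(mu - m) i 0]mxE [(- m) i 0]mxE; ring.
Qed.

End AeBounded.

(** * Reduction of the Riemannian covariance to a Euclidean trace *)

Unset Implicit Arguments.
Set Strict Implicit.

Theorem theorem3p4 (R : realType) (n : nat) (d : measure_display)
    (T : measurableType d) (P : probability T R) (X Y : T -> 'cV[R]_n)
    (mu nu : 'cV[R]_n) (alpha : R -> 'cV[R]_n)
    (hX : random_vector X) (hY : random_vector Y)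
    (bX : ae_bounded P euclidean_metric X)
    (bY : ae_bounded P euclidean_metric Y)
    (hmu : frechet_mean P euclidean_metric X mu)
    (hnu : frechet_mean P euclidean_metric Y nu)
    (halpha : minimizing_geodesic euclidean_metric mu nu alpha)
    (p : 'cV[R]_n)
    (hp : exists2 t : R, 0 <= t <= 1 & p = mu + t *: (nu - mu))
    (B : 'M[R]_n) (hB : orthonormal_basis euclidean_metric p B) :
  riemannian_covariance P euclidean_metric X Y mu nu alpha p B =
  \tr (mx_expectation P (fun w =>
         (X w - mx_expectation P X) *m (Y w - mx_expectation P Y)^T)).
Proof.
have [t /andP[t0 t1] pE] := hp.
have t01 : t \in `[0, 1] by rewrite in_itv/= t0 t1.
have [ga a0 a1 _] := halpha.
(* As [alpha] is affine from [mu] to [nu], it meets [p] at the parameter [t] of [p] on the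
   segment. *)
have at_p : alpha t = p.
  rewrite (geodesic_euclidean_affine ga t01) geodesic_euclidean_velocity//.
  by rewrite a0 a1 pE.
have tmu v : transport euclidean_metric alpha mu p v = v.
  by rewrite -a0 -at_p; exact: transport_euclidean in01_0 t01.
have tnu v : transport euclidean_metric alpha nu p v = v.
  by rewrite -a1 -at_p; exact: transport_euclidean in01_1 t01.
rewrite -(frechet_mean_euclidean hX bX hmu) -(frechet_mean_euclidean hY bY hnu).
(* Orthonormality gives a left inverse; for a square matrix it is also a right inverse, which the
   trace below needs. *)
have BB : B *m B^T = 1%:M.
  by apply: mulmx1C; move: hB; rewrite /orthonormal_basis /euclidean_metric mulmx1.
have bc Z (c : 'cV[R]_n) : random_vector Z -> ae_bounded P euclidean_metric Z ->
    forall i j, ae_bounded_fun P (fun w => (Z w - c) i j).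
  move=> mZ bZ i j; rewrite (_ : (fun w => _) = fun w => Z w i j - c i j).
    by apply: ae_bounded_funD; [exact: ae_bounded_coord|exact: ae_bounded_fun_cst].
  by apply/funext => w; rewrite !mxE.
have bB Z (c : 'cV[R]_n) : random_vector Z -> ae_bounded P euclidean_metric Z ->
    forall i j, ae_bounded_fun P (fun w => (B^T *m (Z w - c)) i j).
  move=> mZ bZ; apply: ae_bounded_fun_mulmx => i j; last exact: bc.
  exact: ae_bounded_fun_cst.
rewrite /riemannian_covariance /cross_covariance.
rewrite (_ : (fun w => _) = fun w =>
    (B^T *m (X w - mu)) *m (B^T *m (Y w - nu))^T); last first.
  apply/funext => w; rewrite tmu tnu !rlog_euclidean.
  by rewrite /basis_coords /euclidean_metric !mulmx1.
have bT k (Z : T -> 'cV[R]_k) :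
    (forall i j, ae_bounded_fun P (fun w => Z w i j)) ->
    forall i j, ae_bounded_fun P (fun w => (Z w)^T i j).
  by move=> bZ i j; under eq_fun do rewrite mxE.
(* Boundedness of the entries moves both traces under the integral, where they agree pointwise:
   cyclicity brings [B] next to [B^T]. *)
rewrite !mxtrace_expectation.
- apply: eq_Rintegral => w _.
  by rewrite trmx_mul trmxK !mulmxA mxtrace_mulC !mulmxA BB mul1mx.
- by apply: ae_bounded_fun_mulmx; [exact: bc|apply: bT; exact: bc].
- by apply: ae_bounded_fun_mulmx; [exact: bB|apply: bT; exact: bB].
Qed.
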